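(* Let $X$ be a real Banach space with continuous dual $X^*$. Let $A\colon X\rightrightarrows X^*$ be a maximal monotone linear relation, let $C$ be a nonempty closed convex subset of $X$, and suppose that $\operatorname{dom} A\cap\operatorname{int} C\neq\varnothing$. Then $A+N_C$ is maximal monotone.
   Context: $\langle\cdot,\cdot\rangle$ denotes the pairing between $X$ and $X^*$. For a set-valued operator $A\colon X\rightrightarrows X^*$, $\operatorname{gra}A=\{(x,x^* )\in X\times X^*: x^*\in Ax\}$ and $\operatorname{dom}A=\{x: Ax\neq\varnothing\}$. $A$ is monotone if $\langle x-y,x^*-y^*\rangle\ge 0$ for all $(x,x^* ),(y,y^* )\in\operatorname{gra}A$, and maximal monotone if it is monotone and no monotone operator has a graph properly containing $\operatorname{gra}A$. $A$ is a linear relation if $\operatorname{gra}A$ is a linear subspace of $X\times X^*$. The normal cone operator of $C$ is $N_C(x)=\{x^*\in X^*:\sup_{c\in C}\langle c-x,x^*\rangle\le 0\}$ if $x\in C$ and $N_C(x)=\varnothing$ otherwise. The sum is $(A+N_C)x=\{a^*+b^*: a^*\in Ax,\ b^*\in N_C(x)\}$. $\operatorname{int}C$ is the interior of $C$. *)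

(* Defs.v *)
(* X is a real Banach space over R : realType;
   elements of the dual X^* are represented as functions X -> R that are
   linear and continuous (predicate [dual_elt]); the pairing <x, x^*> is
   application x^* x. Set-valued operators X ⇉ X^* are maps X -> set (X -> R). *)
From HB Require Import structures.
From mathcomp Require Import all_boot all_order all_algebra.
From mathcomp Require Import all_classical all_reals all_analysis.
Set Implicit Arguments. Unset Strict Implicit. Unset Printing Implicit Defensive.
Import Order.TTheory GRing.Theory Num.Theory.
Import numFieldNormedType.Exports.
Local Open Scope classical_set_scope.
Local Open Scope ring_scope.

Section Defs.
Variables (R : realType) (X : normedModType R).

Definition dual_elt (f : X -> R) : Prop :=
  (forall (a : R) (x y : X), f (a *: x + y) = a * f x + f y) /\ continuous f.

Definition operator := X -> set (X -> R).

Definition is_dual_operator (A : operator) : Prop :=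
  forall x f, A x f -> dual_elt f.

Definition dom_op (A : operator) : set X := [set x | exists f, A x f].

Definition monotone_op (A : operator) : Prop :=
  forall x f y g, A x f -> A y g -> 0 <= f (x - y) - g (x - y).

Definition maximal_monotone (A : operator) : Prop :=
  [/\ is_dual_operator A, monotone_op A &
      forall B : operator, is_dual_operator B -> monotone_op B ->
        (forall x, A x `<=` B x) -> forall x, B x `<=` A x].

Definition linear_relation (A : operator) : Prop :=
  [/\ A 0 (fun _ => 0),
      forall x f y g, A x f -> A y g -> A (x + y) (fun z => f z + g z) &
      forall (a : R) x f, A x f -> A (a *: x) (fun z => a * f z)].

Definition convex_set_X (C : set X) : Prop :=
  forall x y (t : R), C x -> C y -> 0 <= t <= 1 -> C (t *: x + (1 - t) *: y).

Definition normal_cone (C : set X) : operator :=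
  fun x => [set g | C x /\ dual_elt g /\ forall c, C c -> g (c - x) <= 0].

Definition sum_op (A B : operator) : operator :=
  fun x => [set h | exists f g, A x f /\ B x g /\ h = (fun z => f z + g z)].

End Defs.

(* Main.v *)
(* Translate so that [0] is interior to [C], and let [(z, zs)] be monotonically
   related to [A + N_C].  That [z] lies in [C] is seen by approximating [z] by a
   point [d] of [dom A] and testing against arbitrarily large multiples of a
   support functional of [C] at the boundary point of [C] on the ray through [d].

   Since [A] is a monotone linear relation, [h(a, f) = <z - a, zs - f>] is convex
   on [gra A], and it is nonnegative where [a] lies in [C].  Because [0] is
   interior to [C], convex duality gives an exact multiplier: a dual element [y]
   with [h(a, f) >= <c - a, y>] for all [(a, f)] in [gra A] and [c] in [C].
   Taking [c = z], maximality of [A] gives [zs - y] in [A z]; then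
   [(a, f) = (z, zs - y)] gives [y] in [N_C z]. *)
Require Import Defs.
From HB Require Import structures.
From mathcomp Require Import all_boot all_order all_algebra.
From mathcomp Require Import all_classical all_reals all_analysis.
From mathcomp Require Import ring lra.
Set Implicit Arguments. Unset Strict Implicit. Unset Printing Implicit Defensive.
Import Order.TTheory GRing.Theory Num.Theory.
Import numFieldNormedType.Exports.
Local Open Scope classical_set_scope.
Local Open Scope ring_scope.

(** * Algebra and continuity of dual elements *)

Section DualElt.
Context {R : realType} {X : normedModType R}.
Implicit Types f g : X -> R.

Lemma dual_eltD f x y : dual_elt f -> f (x + y) = f x + f y.
Proof. by case=> fl _; rewrite -[x in LHS]scale1r fl mul1r. Qed.

Lemma dual_elt0 f : dual_elt f -> f 0 = 0.
Proof. by move=> /(dual_eltD 0 0); rewrite addr0 => h; lra. Qed.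

Lemma dual_eltZ f (a : R) x : dual_elt f -> f (a *: x) = a * f x.
Proof.
by move=> df; case: (df) => fl _; rewrite -[a *: x]addr0 fl dual_elt0// addr0.
Qed.

Lemma dual_eltB f x y : dual_elt f -> f (x - y) = f x - f y.
Proof. by move=> df; rewrite dual_eltD// -scaleN1r dual_eltZ// mulN1r. Qed.

Lemma dual_elt_lin f g (a : R) :
  dual_elt f -> dual_elt g -> dual_elt (fun x => f x + a * g x).
Proof.
move=> [fl fc] [gl gc]; split=> [b x y|x]; first by rewrite fl gl; ring.
by apply: cvgD; [exact: fc|apply: cvgMr; exact: gc].
Qed.

(** The ball is symmetric, so the one-sided bound, used at [x] and at [- x], bounds the absolute
    value. *)
Lemma dual_elt_of_bound f (r M : R) : 0 < r ->
  (forall (a : R) x y, f (a *: x + y) = a * f x + f y) ->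
  (forall x, `|x| < r -> f x <= M) -> dual_elt f.
Proof.
move=> r0 fl fM; split => //.
have f0 : f 0 = 0 by have := fl 1 0 0; rewrite scaler0 addr0 mul1r; lra.
have fN x : f (- x) = - f x.
  by rewrite -scaleN1r -[_ *: _]addr0 fl f0 addr0 mulN1r.
pose F := GRing.isLinear.Build R X R^o *%R f fl.
pose fL : {linear X -> R^o} := HB.pack f F.
apply: (@bounded_linear_continuous R X R^o fL).
apply/ex_bound; exists M; apply/nbhs_norm0P; exists r => //= x /= xr.
by rewrite ler_norml fM// andbT lerNl -fN fM// normrN.
Qed.

End DualElt.

(** * Linear minorants of convex sets in [X * R], in the spirit of Hahn-Banach *)

Section ConeMinorant.
Context {R : realType} {X : normedModType R}.
Implicit Types K : set (X * R).

(** Models the epigraph of a sublinear function; once all fibres are nonempty, the last clause keeps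
    their infima finite. *)
Definition epi_cone K :=
  [/\ forall u v (m n : R), K (u, m) -> K (v, n) -> K (u + v, m + n),
      forall (t : R) u m, 0 < t -> K (u, m) -> K (t *: u, t * m) &
      forall m, K (0, m) -> 0 <= m].

(** Zorn's lemma runs over the sets [S] whose union with [K0] is an epi-cone, so that the empty
    chain needs no separate treatment. *)
Lemma ex_maximal_epi_cone K0 : epi_cone K0 ->
  exists K, [/\ K0 `<=` K, epi_cone K &
    forall K', epi_cone K' -> K `<=` K' -> K' `<=` K].
Proof.
move=> K0c.
have [|S [Sc Smax]] := @Zorn_bigcup _ (fun S => epi_cone (K0 `|` S)).
  move=> F Fc Ftot; split.
  - have [K0D _ _] := K0c.
    have FD S p q : F S -> (K0 `|` S) p -> (K0 `|` S) q ->
        (K0 `|` \bigcup_(S in F) S) (p.1 + q.1, p.2 + q.2).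
      move=> FS; case: p q => [u m] [v n] Kp Kq.
      have [SD _ _] := Fc _ FS.
      by case: (SD _ _ _ _ Kp Kq) => /= ?; [left|right; exists S].
    move=> u v m n [Kp|[S FS Sp]] [Kq|[S' FS' Sq]].
    + by left; exact: K0D.
    + by apply: (FD S' (u, m) (v, n)) => //; [left|right].
    + by apply: (FD S (u, m) (v, n)) => //; [right|left].
    + have [SS'|SS'] := Ftot _ _ FS FS'.
        by apply: (FD S' (u, m) (v, n)) => //; right; do ?exact: SS'.
      by apply: (FD S (u, m) (v, n)) => //; right; do ?exact: SS'.
  - move=> t u m t0 [Kp|[S FS Sp]]; first by left; have [_ K0Z _] := K0c; exact: K0Z.
    have [_ SZ _] := Fc _ FS.
    by case: (SZ t u m t0 (or_intror Sp)) => ?; [left|right; exists S].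
  - move=> m [Kp|[S FS Sp]]; first by have [_ _ K00] := K0c; exact: K00.
    by have [_ _ +] := Fc _ FS; apply; right.
exists (K0 `|` S); split => //.
move=> K' K'c sub p K'p; apply: contrapT => np.
apply: (Smax K').
  split=> [q Sq|]; first by apply: sub; right.
  by move=> /(_ p K'p) Sp; apply: np; right.
suff -> : K0 `|` K' = K' by [].
by apply: setUidr => q Kq; apply: sub; left.
Qed.

(* The infimum over the fibres of a maximal cone is sublinear, and maximality
   makes it odd, hence linear. *)
Lemma epi_cone_minorant K (r M : R) : 0 < r -> epi_cone K -> K (0, 0) ->
  (forall u, `|u| < r -> K (u, M)) ->
  exists2 y, dual_elt y & forall u m, K (u, m) -> y u <= m.
Proof.
move=> r0 /ex_maximal_epi_cone[L [KL [LD LZ L0] Lmax]] /KL L00 KM.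
suff [y dy yL] : exists2 y, dual_elt y & forall u m, L (u, m) -> y u <= m.
  by exists y => // u m /KL /yL.
have {KM KL} LM u : `|u| < r -> L (u, M) by move=> /KM /KL.
move: L LD LZ L0 Lmax L00 LM => {}K KD KZ K0 Kmax K00 KM.
(* By maximality, adjoining the ray through [(v, s)] must break the last clause of [epi_cone]: some
   [(u, m)] in [K] plus [t] times [(v, s)] lies over 0 at negative height. Then [t] is positive, and
   dividing [(u, m)] by [t] gives the point over [- v]. *)
have opp_in v s : ~ K (v, s) -> exists2 m, K (- v, m) & m < - s.
  move=> nK; apply: contrapT => nex.
  pose K' := [set p : X * R | exists u m t, [/\ K (u, m), 0 <= t &
    p = (u + t *: v, m + t * s)]].
  apply: nK; apply: (Kmax K'); last 2 first.
  - by move=> [u m] Ku; exists u, m, 0; rewrite scale0r mul0r !addr0.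
  - by exists 0, 0, 1; rewrite scale1r mul1r !add0r.
  split.
  - move=> u' v' m' n' [u1 [m1 [t1 [K1 t10 [-> ->]]]]].
    move=> [u2 [m2 [t2 [K2 t20 [-> ->]]]]].
    exists (u1 + u2), (m1 + m2), (t1 + t2); split; rewrite ?addr_ge0//.
      exact: KD.
    by congr pair; [rewrite scalerDl addrACA|ring].
  - move=> a u' m' a0 [u [m [t [Ku t0 [-> ->]]]]].
    exists (a *: u), (a * m), (a * t); split; rewrite ?mulr_ge0 ?(ltW a0)//.
      exact: KZ.
    by rewrite scalerDr scalerA mulrDr mulrA.
  - move=> m' [u [m [t [Ku t0 [/esym/eqP + ->]]]]].
    move: t0; rewrite le_eqVlt => /predU1P[<-|t0].
      by rewrite scale0r addr0 mul0r addr0 => /eqP u0; apply: K0; rewrite -u0.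
    rewrite addr_eq0 => /eqP uE; rewrite leNgt; apply/negP => mt.
    apply: nex; exists (t^-1 * m).
      by have := KZ t^-1 _ _ _ Ku; rewrite uE scalerN scalerA mulVf ?gt_eqF// scale1r invr_gt0; apply.
    by rewrite -(ltr_pM2l t0) mulrA divff ?gt_eqF//; lra.
have Kex u : exists m, K (u, m).
  pose t := r / (2 * (`|u| + 1)).
  have u1 : 0 < `|u| + 1 by rewrite ltr_wpDl.
  have t0 : 0 < t by rewrite divr_gt0// mulr_gt0.
  have /KM /(KZ t^-1) : `|t *: u| < r.
    rewrite normrZ gtr0_norm// /t mulrAC ltr_pdivrMr ?mulr_gt0//.
    rewrite ltr_pM2l//; have := normr_ge0 u; lra.
  rewrite scalerA mulVf ?gt_eqF// scale1r invr_gt0 => /(_ t0).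
  by exists (t^-1 * M).
pose y u := inf [set m | K (u, m)].
have ylb u : has_lbound [set m | K (u, m)].
  have [m Km] := Kex (- u); exists (- m) => n /= Kn.
  by have := KD _ _ _ _ Km Kn; rewrite addNr => /K0; lra.
have yle u m : K (u, m) -> y u <= m by move=> Ku; apply: ge_inf.
have yge u b : (forall m, K (u, m) -> b <= m) -> b <= y u.
  by move=> h; apply: lb_le_inf; [exact: Kex|move=> m; exact: h].
have yD u v : y (u + v) <= y u + y v.
  rewrite -lerBlDr; apply: (yge) => m Km; rewrite lerBlDr [m + _]addrC -lerBlDr.
  by apply: (yge) => n Kn; rewrite lerBlDr [n + m]addrC yle//; exact: KD.
(* The point [(u, y u - e)] is below the fibre infimum, hence outside [K], and [opp_in] bounds
   [y (- u)] by [e - y u]. The converse adds points of opposite fibres. *)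
have yN u : y (- u) = - y u.
  apply/eqP; rewrite eq_le; apply/andP; split.
    rewrite lerNr; apply/ler_addgt0Pl => e e0.
    have : ~ K (u, y u - e) by move=> /yle; lra.
    by move=> /opp_in[m /yle]; lra.
  rewrite lerNl; apply: (yge) => m Km; rewrite lerNl; apply: (yge) => n Kn.
  by have := KD _ _ _ _ Kn Km; rewrite addNr => /K0; lra.
have y0 : y 0 = 0 by have := yN 0; rewrite oppr0; lra.
have yZ_le t u : 0 < t -> t * y u <= y (t *: u).
  move=> t0; apply: (yge) => m /(KZ t^-1); rewrite invr_gt0 => /(_ t0).
  rewrite scalerA mulVf ?gt_eqF// scale1r => /yle.
  by rewrite ler_pdivlMl.
have yZp t u : 0 < t -> y (t *: u) = t * y u.
  move=> t0; apply/eqP; rewrite eq_le yZ_le// andbT.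
  have := yZ_le t^-1 (t *: u); rewrite invr_gt0 => /(_ t0).
  by rewrite scalerA mulVf ?gt_eqF// scale1r ler_pdivrMl.
have yZ t u : y (t *: u) = t * y u.
  have [t0|t0|->] := ltgtP t 0; last by rewrite scale0r mul0r.
    by rewrite -{1}[t]opprK scaleNr yN yZp ?oppr_gt0//; ring.
  exact: yZp.
have yDE u v : y (u + v) = y u + y v.
  apply/eqP; rewrite eq_le yD/=.
  by have := yD (- u) (- v); rewrite -opprD !yN; lra.
exists y => //; apply: (@dual_elt_of_bound _ _ _ r M) => // [a u v|u ur].
  by rewrite yDE yZ.
by apply/yle/KM.
Qed.

(** The cone generated by [E] is an epi-cone, and a minorant of it is one of [E]. The constant
    height over a ball supplies continuity. *)
Lemma convex_minorant (E : set (X * R)) (r M : R) : 0 < r ->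
  (forall u v (m n t : R), E (u, m) -> E (v, n) -> 0 <= t <= 1 ->
     E (t *: u + (1 - t) *: v, t * m + (1 - t) * n)) ->
  (forall m, E (0, m) -> 0 <= m) ->
  (forall u, `|u| < r -> E (u, M)) ->
  exists2 y, dual_elt y & forall u m, E (u, m) -> y u <= m.
Proof.
move=> r0 Econv E0 EM.
pose K := [set p : X * R | exists s u m, [/\ 0 <= s, E (u, m) &
  p = (s *: u, s * m)]].
have EK u m : E (u, m) -> K (u, m) by exists 1, u, m; rewrite scale1r mul1r.
have K00 : K (0, 0).
  by exists 0, 0, M; rewrite scale0r mul0r; split => //; apply: EM; rewrite normr0.
have [|||y dy yK] := @epi_cone_minorant K r M r0 => //; first split.
- move=> _ _ _ _ [s1 [u1 [m1 [s10 E1 [-> ->]]]]] [s2 [u2 [m2 [s20 E2 [-> ->]]]]].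
  (* Either both factors vanish and the sum is the apex, or the sum is [s1 + s2] times a convex
     combination of points of [E]. *)
  have := addr_ge0 s10 s20; rewrite le_eqVlt => /predU1P[/esym s0|s0].
    have -> : s1 = 0 by lra.
    have -> : s2 = 0 by lra.
    by rewrite !scale0r !mul0r !addr0.
  have s2E : 1 - s1 / (s1 + s2) = s2 / (s1 + s2) by field; rewrite gt_eqF.
  have s2E' : (s1 + s2) * (s2 / (s1 + s2)) = s2 by field; rewrite gt_eqF.
  have s1E' : (s1 + s2) * (s1 / (s1 + s2)) = s1 by field; rewrite gt_eqF.
  exists (s1 + s2), (s1 / (s1 + s2) *: u1 + (1 - s1 / (s1 + s2)) *: u2),
    (s1 / (s1 + s2) * m1 + (1 - s1 / (s1 + s2)) * m2); split; first exact: ltW.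
    by apply: Econv; rewrite // divr_ge0 ?(ltW s0)//= ler_pdivrMr//; lra.
  by rewrite s2E scalerDr !scalerA s1E' s2E' mulrDr [(s1 + s2) * (_ * m1)]mulrA s1E' [_ * (_ * m2)]mulrA s2E'.
- move=> t _ _ t0 [s [u [m [s0 Eu [-> ->]]]]].
  by exists (t * s), u, m; rewrite mulr_ge0 ?(ltW t0)// scalerA mulrA.
- move=> _ [s [u [m [s0 Eu [/esym/eqP + ->]]]]].
  rewrite scaler_eq0 => /orP[/eqP->|/eqP u0]; first by rewrite mul0r.
  by rewrite mulr_ge0// E0// -u0.
- by move=> u ur; apply/EK/EM.
by exists y => // u m /EK/yK.
Qed.

End ConeMinorant.

Section SupportFunctionals.
Context {R : realType} {X : normedModType R}.
Implicit Types (C D : set X) (x z : X).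

(** Height [1 - t] is prescribed over [c - t *: z]; over 0 this puts [t *: z] in [C], so [t <= 1]
    and the height is nonnegative. The minorant satisfies [y c - t * y z <= 1 - t]: [t = 0] gives
    the bound on [C], large [t] the bound at [z]. *)
Lemma support_functional C (r : R) z : 0 < r -> convex_set_X C ->
  (forall u, `|u| < r -> C u) -> (forall t : R, 1 < t -> ~ C (t *: z)) ->
  exists y, [/\ dual_elt y, forall c, C c -> y c <= 1 & 1 <= y z].
Proof.
move=> r0 Cconv Cr nC.
pose E := [set p : X * R | exists c t, [/\ C c, 0 <= t, 1 - t <= p.2 &
  p.1 = c - t *: z]].
have [|||y dy yE] := @convex_minorant _ _ E r 1 r0.
- move=> u v m n t [c1 [t1 [/= C1 t10 m1 ->]]] [c2 [t2 [/= C2 t20 m2 ->]]] t01.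
  have /andP[t0 t1'] := t01.
  exists (t *: c1 + (1 - t) *: c2), (t * t1 + (1 - t) * t2); split => /=.
  + exact: Cconv.
  + by rewrite addr_ge0 ?mulr_ge0// subr_ge0.
  + have := ler_wpM2l t0 m1.
    by have := ler_wpM2l (_ : 0 <= 1 - t) m2; rewrite subr_ge0 => /(_ t1'); lra.
  + by rewrite !scalerBr [(_ * _ + _) *: z]scalerDl opprD !scalerA addrACA.
- move=> m [c [t [/= Cc t0 mt /esym/eqP]]]; rewrite subr_eq0 => /eqP cE.
  rewrite (le_trans _ mt)// subr_ge0 leNgt; apply/negP => /nC; apply.
  by rewrite -cE.
- by move=> u ur; exists u, 0; rewrite scale0r !subr0; split => //; exact: Cr.
have yCz c t : C c -> 0 <= t -> y c - t * y z <= 1 - t.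
  move=> Cc t0; rewrite -dual_eltZ// -dual_eltB//.
  by apply: yE; exists c, t; split.
exists y; split => // [c Cc|]; first by have := yCz c 0 Cc (lexx 0); lra.
rewrite leNgt; apply/negP => yz.
have C0 : C 0 by apply: Cr; rewrite normr0.
(* This [t] makes [t * (1 - y z)] equal to 2, whereas [yCz] at [c = 0] bounds it by 1. *)
have := yCz 0 (2 / (1 - y z)) C0; rewrite dual_elt0//.
have yz0 : 0 < 1 - y z by lra.
rewrite divr_ge0 ?(ltW yz0)// => /(_ isT).
suff : 2 / (1 - y z) * (1 - y z) = 2 by lra.
by rewrite divfK ?gt_eqF.
Qed.

(** Otherwise the open [e]-neighbourhood of [D] misses [z] and has a support functional that is at
    most 1 on the subspace [D], hence zero there, yet at least 1 at [z]. *)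
Lemma subspace_approx D z : D 0 ->
  (forall (a : R) x y, D x -> D y -> D (a *: x + y)) ->
  (forall w, dual_elt w -> (forall x, D x -> w x = 0) -> w z = 0) ->
  forall e : R, 0 < e -> exists2 d, D d & `|z - d| < e.
Proof.
move=> D0 Dlin Dz e e0; apply: contrapT => far.
have DZ (a : R) x : D x -> D (a *: x) by rewrite -[a *: x]addr0 => ?; exact: Dlin.
have DD x y : D x -> D y -> D (x + y) by rewrite -{2}[x]scale1r; exact: Dlin.
pose C := [set x | exists d v, [/\ D d, `|v| < e & x = d + v]].
have [|||y [dy yC yz]] := @support_functional C e z e0.
- move=> _ _ t [d1 [v1 [D1 v1e ->]]] [d2 [v2 [D2 v2e ->]]] /andP[t0 t1].
  exists (t *: d1 + (1 - t) *: d2), (t *: v1 + (1 - t) *: v2); split.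
  + by apply: DD; exact: DZ.
  + rewrite (le_lt_trans (ler_normD _ _))// !normrZ ger0_norm// ger0_norm ?subr_ge0//.
    have [->|tN0] := eqVneq t 0; first by rewrite mul0r add0r subr0 mul1r.
    have {}t0 : 0 < t by rewrite lt_neqAle eq_sym tN0.
    have : t * `|v1| < t * e by rewrite ltr_pM2l.
    have : (1 - t) * `|v2| <= (1 - t) * e by rewrite ler_wpM2l ?subr_ge0// ltW.
    lra.
  + by rewrite !scalerDr addrACA.
- by move=> u ue; exists 0, u; rewrite add0r.
- move=> t t1 [d [v [Dd ve tz]]]; apply: far; exists (t^-1 *: d); first exact: DZ.
  have t0 : 0 < t by lra.
  have -> : z - t^-1 *: d = t^-1 *: v.
    apply: (scalerI (lt0r_neq0 t0)).
    by rewrite scalerBr !scalerA divff ?gt_eqF// !scale1r tz addrC addKr.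
  rewrite normrZ gtr0_norm ?invr_gt0// mulrC ltr_pdivrMr// (lt_le_trans ve)//.
  by rewrite ler_peMr ?ltW.
have yD x : D x -> y x = 0.
  move=> Dx; apply/eqP/negP => /negP yx0.
  have : C ((2 / y x) *: x).
    by exists ((2 / y x) *: x), 0; rewrite normr0 addr0; split => //; exact: DZ.
  by move=> /yC; rewrite dual_eltZ// divfK//; lra.
by move: yz; rewrite (Dz y dy yD); lra.
Qed.

(** The radius [e] must not depend on [d], which will be any domain point close to [z]. With
    [l *: d] the last point of [C] on the ray, [y (z - l *: d)] is [(1 - l) * y d + y (z - d)]: the
    first term is bounded below uniformly in [d], the second is small. *)
Lemma support_near_ray C (r : R) z : 0 < r -> convex_set_X C -> closed C ->
  (forall u, `|u| < r -> C u) -> ~ C z ->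
  exists2 e : R, 0 < e & forall d, `|z - d| < e ->
    exists (l : R) y, [/\ C (l *: d), dual_elt y,
      forall c, C c -> y c <= y (l *: d) & 0 < y (z - l *: d)].
Proof.
move=> r0 Cconv Ccl Cr nCz.
have [del del0 Cdel] : exists2 del : R, 0 < del & forall c, C c -> del <= `|z - c|.
  have : nbhs z (~` C) by apply: open_nbhs_nbhs; split => //; exact: closed_openC.
  move=> /nbhs_ballP[del /= del0 zC]; exists del => // c Cc.
  by rewrite leNgt; apply/negP => zc; apply: (zC c) => //; rewrite -ball_normE.
pose N := `|z| + 1.
have N0 : 0 < N by rewrite ltr_wpDl.
pose k := del * r / (8 * N).
have k0 : 0 < k by rewrite divr_gt0 ?mulr_gt0.
(* The bound [del / 2] keeps [d] outside [C] and leaves [(1 - l) * |d|] above [del / 2]; the bound 1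
   gives [|d| < N], so [1 - l] is at least [del / (2 * N)]. As [y <= 1] on the [r]-ball, the bound
   [k] keeps [y (z - d)] above minus half of that. *)
exists (Num.min (del / 2) (Num.min 1 k)).
  by rewrite !lt_min k0 ltr01 divr_gt0.
move=> d; rewrite !lt_min => /and3P[zd_del zd1 zdk].
have C0 : C 0 by apply: Cr; rewrite normr0.
have dN : `|d| < N.
  rewrite /N (_ : d = z - (z - d)); last by rewrite opprB addrC subrK.
  by rewrite (le_lt_trans (ler_normB _ _))// ltrD2l.
(* The supremum of [S] is attained because [C] is closed, and is at most 1: a point of [C] beyond
   [d] would put [d] in [C] by convexity with 0. *)
pose S := [set t : R | C (t *: d)].
have S0 : S 0 by rewrite /S/= scale0r.
have Sub : ubound S 1.
  move=> t /= St; rewrite leNgt; apply/negP => t1.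
  have t0 : 0 < t by lra.
  have : C d.
    have -> : d = t^-1 *: (t *: d) + (1 - t^-1) *: 0.
      by rewrite scaler0 addr0 scalerA mulVf ?gt_eqF// scale1r.
    by apply: Cconv; rewrite // invr_ge0 (ltW t0)/= invf_le1// ltW.
  by move=> /Cdel; lra.
have hubS : has_ubound S by exists 1.
pose l := sup S.
have Sl : S l.
  have Scl : closed S.
    apply: (@preimage_closed _ _ (fun t : R => t *: d) C) => //.
    by move=> t _; exact: scalel_continuous.
  by rewrite -/S; apply: Scl; apply: closure_sup => //; exists 0.
have lub t : C (t *: d) -> t <= l by move=> ?; exact: ub_le_sup.
have l1 : l <= 1 by exact: Sub.
have l0 : 0 < l.
  apply: (@lt_le_trans _ _ (r / N)); first by rewrite divr_gt0.
  apply/lub/Cr; rewrite normrZ gtr0_norm ?divr_gt0// mulrAC ltr_pdivrMr//.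
  by rewrite ltr_pM2l.
have [|y [dy yC yl]] := @support_functional C r (l *: d) r0 Cconv Cr.
  by move=> t t1; rewrite scalerA => /lub; apply/negP; rewrite -ltNge ltr_pMl.
exists l, y; split => // [c /yC|]; first by move=> /le_trans; apply.
have yd : 1 <= y d.
  move: yl; rewrite dual_eltZ// => yl.
  have yd0 : 0 < y d by rewrite -(pmulr_rgt0 _ l0); lra.
  by rewrite (le_trans yl)// ger_pMl.
have -> : z - l *: d = (1 - l) *: d + (z - d).
  by rewrite scalerBl scale1r [RHS]addrC addrA subrK.
have yzd : - (del / (4 * N)) <= y (z - d).
  have kr : k * (4 * N) / del = r / 2 by rewrite /k; field; rewrite !gt_eqF.
  have : y (- (4 * N / del) *: (z - d)) <= 1.
    apply/yC/Cr; rewrite normrZ normrN gtr0_norm ?divr_gt0 ?mulr_gt0//.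
    rewrite (@lt_trans _ _ (4 * N / del * k))//.
      by rewrite ltr_pM2l// divr_gt0 ?mulr_gt0.
    by rewrite (_ : _ * k = r / 2) -?kr; [lra|ring].
  rewrite dual_eltZ// mulNr lerNl -ler_pdivrMl ?divr_gt0 ?mulr_gt0//.
  by rewrite invf_div mulrN1.
have ld : del / (2 * N) <= 1 - l.
  have := Cdel _ Sl.
  have -> : z - l *: d = (1 - l) *: d + (z - d).
    by rewrite scalerBl scale1r [RHS]addrC addrA subrK.
  move=> /le_trans/(_ (ler_normD _ _)); rewrite normrZ ger0_norm ?subr_ge0// => h.
  rewrite ler_pdivrMr ?mulr_gt0//.
  have : (1 - l) * `|d| <= (1 - l) * N by rewrite ler_wpM2l ?subr_ge0// ltW.
  lra.
rewrite dual_eltD// dual_eltZ//.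
have : (1 - l) <= (1 - l) * y d by rewrite ler_peMr// subr_ge0.
have : del / (2 * N) = 2 * (del / (4 * N)) by field; rewrite gt_eqF.
have : 0 < del / (4 * N) by rewrite divr_gt0 ?mulr_gt0.
lra.
Qed.

End SupportFunctionals.

(** * Pairs monotonically related to the sum, with 0 interior to [C] *)

Section MaximalMonotone.
Context {R : realType} {X : normedModType R}.
Implicit Types (A : operator X) (C : set X).

(** Adjoining [(x, f)] to the graph preserves monotonicity. *)
Lemma maximal_monotone_related A x f : maximal_monotone A -> dual_elt f ->
  (forall a g, A a g -> 0 <= f (x - a) - g (x - a)) -> A x f.
Proof.
move=> [Ad Am Amax] df rel.
apply: (Amax (fun y => A y `|` [set g | y = x /\ g = f])); last by right.
- by move=> y g [/Ad//|[_ ->]].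
- move=> y g y' g' [Ag|[-> ->]] [Ag'|[-> ->]].
  + exact: Am.
  + have dg := Ad _ _ Ag; have := rel _ _ Ag.
    by rewrite !(dual_eltB _ _ df) !(dual_eltB _ _ dg); lra.
  + exact: rel.
  + by rewrite subrr.
- by move=> y g Ag; left.
Qed.

Lemma sum_of_multiplier A C z zs y : maximal_monotone A ->
  dual_elt zs -> dual_elt y -> C z ->
  (forall a f c, A a f -> C c -> y (c - a) <= zs (z - a) - f (z - a)) ->
  sum_op A (normal_cone C) z zs.
Proof.
move=> Amax dzs dy Cz le_h.
have Az : A z (fun x => zs x + (-1) * y x).
  apply: maximal_monotone_related => // [|a f Af]; first exact: dual_elt_lin.
  by have := le_h a f z Af Cz; lra.
exists (fun x => zs x + (-1) * y x), y; split => //; split.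
  split => //; split => // c Cc.
  have := le_h _ _ _ Az Cc.
  by rewrite subrr (dual_elt0 dzs) (dual_elt0 dy); lra.
by apply/funext => x; ring.
Qed.

Section Related.
Variables (A : operator X) (C : set X) (r : R) (z : X) (zs : X -> R).
Hypotheses (Amax : maximal_monotone A) (Alin : linear_relation A).
Hypotheses (Cconv : convex_set_X C) (r0 : 0 < r).
Hypothesis Cr : forall u, `|u| < r -> C u.
Hypothesis dzs : dual_elt zs.
Hypothesis rel : forall a f g, A a f -> normal_cone C a g ->
  0 <= zs (z - a) - (f (z - a) + g (z - a)).

Let dualA a f : A a f -> dual_elt f. Proof. by case: Amax => + _ _; exact. Qed.

Let A00 : A 0 (fun=> 0). Proof. by case: Alin. Qed.

Let C0 : C 0. Proof. by apply: Cr; rewrite normr0. Qed.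

Let normal0 a : C a -> normal_cone C a (fun=> 0).
Proof.
move=> Ca; split=> //; split=> //.
by split=> [b x y|]; [rewrite mulr0 addr0|exact: cst_continuous].
Qed.

Let not_unbounded (p q : R) : 0 < q -> ~ (forall s, 0 <= s -> 0 <= p - s * q).
Proof.
move=> q0 /(_ ((`|p| + 1) / q)) h; have := ler_norm p.
suff : 0 <= p - (`|p| + 1) by lra.
by rewrite -[X in p - X](divfK (lt0r_neq0 q0)) h// divr_ge0 ?addr_ge0// ltW.
Qed.

(** If [w] vanishes on the domain, then [(0, w)] is related to [A], so maximality and linearity put
    every multiple of [w] in [A 0]. Relatedness at the point 0 then forces [w z = 0]. *)
Lemma related_dom_closure (e : R) : 0 < e ->
  exists2 d, dom_op A d & `|z - d| < e.
Proof.
have [_ AD AZ] := Alin.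
apply: subspace_approx => [|a x y [f Af] [g Ag]|w dw wD].
- by exists (fun=> 0).
- by exists (fun z => a * f z + g z); apply: AD => //; exact: AZ.
have A0w (s : R) : A 0 (fun x => s * w x).
  rewrite -[X in A X _](scaler0 X s); apply: AZ.
  apply: maximal_monotone_related => // a g Ag.
  have dg := dualA Ag; have [_ Am _] := Amax; have := Am _ _ _ _ Ag A00.
  rewrite !(dual_eltB _ _ dw) !(dual_eltB _ _ dg) (dual_elt0 dw) (dual_elt0 dg).
  by rewrite wD; [lra|exists g].
apply/eqP/negP => /negP wz.
(* Testing with the multiple [s * w z] of [w] produces a square, which handles both signs of
   [w z]. *)
have := @not_unbounded (zs z) (w z ^+ 2).
rewrite exprn_even_gt0//= => /(_ wz); apply => s s0.
by have := rel (A0w (s * w z)) (normal0 C0); rewrite subr0 addr0; lra.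
Qed.

Lemma related_in_set : closed C -> C z.
Proof.
move=> Ccl; apply: contrapT => nCz.
have [e e0 He] := support_near_ray r0 Cconv Ccl Cr nCz.
have [d [f Af] /He[l [y [Cld dy yC yz]]]] := related_dom_closure e0.
(* Linearity moves the domain point [d] to [l *: d], where all nonnegative multiples of [y] are
   normal to [C]. *)
have [_ _ AZ] := Alin; have {}Af := AZ l _ _ Af.
apply: (@not_unbounded (zs (z - l *: d) - l * f (z - l *: d)) _ yz) => s s0.
have Ns : normal_cone C (l *: d) (fun x => s * y x).
  split => //; split.
    have [yl yc] := dy; split=> [a u v|x]; first by rewrite yl; ring.
    by apply: cvgMr; exact: yc.
  by move=> c Cc; rewrite mulr_ge0_le0// dual_eltB// subr_le0 yC.
by have := rel Af Ns; lra.
Qed.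

Lemma related_sum : closed C -> sum_op A (normal_cone C) z zs.
Proof.
move=> /related_in_set Cz; have [_ AD AZ] := Alin; have [_ Am _] := Amax.
(* Over 0 the point [a] lies in [C], and relatedness with the zero normal gives nonnegative heights.
   Over the [r]-ball, the pair [(0, 0)] of [A] gives height [zs z]. *)
pose E := [set p : X * R | exists a f c, [/\ A a f, C c, p.1 = c - a &
  zs (z - a) - f (z - a) <= p.2]].
have [|||y dy yE] := @convex_minorant _ _ E r (zs z) r0.
- move=> u v m n t [a1 [f1 [c1 [/= A1 C1 -> m1]]]] [a2 [f2 [c2 [/= A2 C2 -> m2]]]].
  move=> t01; have /andP[t0 t1] := t01.
  exists (t *: a1 + (1 - t) *: a2), (fun x => t * f1 x + (1 - t) * f2 x),
    (t *: c1 + (1 - t) *: c2); split => /=.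
  + by apply: AD; exact: AZ.
  + exact: Cconv.
  + by rewrite !scalerBr opprD addrACA.
  (* The convexity defect of the height is [t * (1 - t)] times the monotonicity pairing of
     [(a1, f1)] and [(a2, f2)]. *)
  + have d1 := dualA A1; have d2 := dualA A2.
    have := Am _ _ _ _ A1 A2; move: m1 m2.
    rewrite !(dual_eltB _ _ dzs) !(dual_eltB _ _ d1) !(dual_eltB _ _ d2).
    rewrite !(dual_eltD _ _ dzs) !(dual_eltD _ _ d1) !(dual_eltD _ _ d2).
    rewrite !(dual_eltZ _ _ dzs) !(dual_eltZ _ _ d1) !(dual_eltZ _ _ d2).
    move=> m1 m2 m12.
    have t1' : 0 <= 1 - t by rewrite subr_ge0.
    have h1 := ler_wpM2l t0 m1; have h2 := ler_wpM2l t1' m2.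
    have := mulr_ge0 (mulr_ge0 t0 t1') m12.
    lra.
- move=> m [a [f [c [/= Af Cc /esym/eqP + hm]]]]; rewrite subr_eq0 => /eqP ca.
  rewrite (le_trans _ hm)//; rewrite ca in Cc.
  by have := rel Af (normal0 Cc); rewrite addr0.
- move=> u ur; exists 0, (fun=> 0), u; split => //=; rewrite ?subr0//.
  exact: Cr.
apply: (sum_of_multiplier Amax dzs dy Cz) => a f c Af Cc.
by apply: yE; exists a, f, c; split.
Qed.

End Related.

Lemma sum_op_monotone A C : is_dual_operator A -> monotone_op A ->
  monotone_op (sum_op A (normal_cone C)).
Proof.
move=> Ad Am x _ y _ [f1 [g1 [A1 [[Cx [d1 N1]] ->]]]] [f2 [g2 [A2 [[Cy [d2 N2]] ->]]]].
have := Am _ _ _ _ A1 A2; have := N2 _ Cx; have := N1 _ Cy.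
by rewrite !(dual_eltB _ _ d1) !(dual_eltB _ _ d2); lra.
Qed.

End MaximalMonotone.

(** * Reduction to the centred case by translation *)

Theorem theorem3p1 (R : realType) (X : completeNormedModType R)
  (A : operator X) (C : set X) :
  maximal_monotone A -> linear_relation A ->
  C !=set0 -> closed C -> convex_set_X C ->
  (dom_op A `&` interior C) !=set0 ->
  maximal_monotone (sum_op A (normal_cone C)).
Proof.
move=> Amax Alin _ Ccl Cconv [x0 [[f0 A0] /nbhs_ballP[r /= r0 Cr]]].
have [Ad Am _] := Amax; have [_ AD AZ] := Alin.
have Sd : is_dual_operator (sum_op A (normal_cone C)).
  move=> x _ [f [g [Af [[_ [dg _]] ->]]]].
  have := dual_elt_lin 1 (Ad _ _ Af) dg.
  by congr dual_elt; apply/funext => u; rewrite mul1r.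
split => //; first exact: sum_op_monotone.
move=> B Bd Bm AB z zs Bz.
(* Translating along [(x0, f0)], itself in the graph of [A], maps that graph to itself; so only [C]
   and the related pair are shifted. *)
have AT (a : R) x f : A x f -> A (x + a *: x0) (fun u => f u + a * f0 u).
  by move=> Af; apply: AD => //; exact: AZ.
pose C' := [set c | C (c + x0)].
have [||||||f [g [Af [[Cz [dg Ng]] fgE]]]] :=
    @related_sum R X A C' r (z - x0) (fun u => zs u + (-1) * f0 u) Amax Alin.
- move=> x y t Cx Cy t01; rewrite /C'/=.
  have := Cconv _ _ _ Cx Cy t01.
  by rewrite !scalerDr addrACA -scalerDl [t + _]addrC subrK scale1r.
- exact: r0.
- move=> u ur; apply: Cr; rewrite -ball_normE/=.
  by rewrite opprD addrCA subrr addr0 normrN.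
- by apply: dual_elt_lin; [exact: Bd Bz|exact: Ad A0].
- move=> a f g Af [Ca [dg Ng]].
  have Sa : sum_op A (normal_cone C) (a + x0) (fun u => (f u + 1 * f0 u) + g u).
    exists (fun u => f u + 1 * f0 u), g; split.
      by have := AT 1 _ _ Af; rewrite scale1r.
    split=> //; split=> //; split=> // c Cc.
    have := Ng (c - x0); rewrite /C'/= subrK => /(_ Cc).
    by rewrite opprD addrA addrAC.
  have := Bm _ _ _ _ Bz (AB _ _ Sa).
  by rewrite opprD addrA [z - a - x0]addrAC; lra.
- apply: (@preimage_closed _ _ (fun c => c + x0) C) => // c _.
  by apply: cvgD; [exact: cvg_id|exact: cvg_cst].
exists (fun u => f u + 1 * f0 u), g; split.
  by have := AT 1 _ _ Af; rewrite scale1r subrK.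
split.
  split; first by move: Cz; rewrite /C'/= subrK.
  split=> // c Cc; have := Ng (c - x0); rewrite /C'/= subrK => /(_ Cc).
  by rewrite opprB addrA subrK.
apply/funext => u; have := congr1 (fun h => h u) fgE => /=; lra.
Qed.
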